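(* Let $F\colon\mathcal{C}\to\mathcal{D}$ and $H\colon\mathcal{C}\to\mathcal{H}$ be functors. (a) If $(LF,\lambda)$ is an absolute right Kan extension of $F$ along $H$, then $$\varphi_{\mathcal{E},X,Y}\colon\operatorname{Nat}(X,Y\circ LF)\to\operatorname{Nat}(X\circ H,Y\circ F),\qquad\tau\mapsto Y\lambda\circ\tau_H$$ is a bijection natural in the category $\mathcal{E}$ and the functors $X\colon\mathcal{H}\to\mathcal{E}$ and $Y\colon\mathcal{D}\to\mathcal{E}$. (b) Conversely, if there is a functor $LF\colon\mathcal{H}\to\mathcal{D}$ together with a family of bijections $\varphi_{\mathcal{E},X,Y}\colon\operatorname{Nat}(X,Y\circ LF)\to\operatorname{Nat}(X\circ H,Y\circ F)$, indexed by all categories $\mathcal{E}$ and functors $X\colon\mathcal{H}\to\mathcal{E}$, $Y\colon\mathcal{D}\to\mathcal{E}$, natural in $\mathcal{E}$ and $X$ (naturality in $Y$ is then automatic), then $(LF,\varphi_{\mathcal{D},LF,\operatorname{id}_{\mathcal{D}}}(\operatorname{id}_{LF}))$ is an absolute right Kan extension of $F$ along $H$. Moreover, the constructions in (a) and (b) are inverse to each other.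
   Context: $\operatorname{Nat}(A,B)$ is the collection of natural transformations $A\Rightarrow B$; $K\tau$ and $\tau_K$ denote post- and pre-whiskering (size issues are ignored, e.g. by working with universes). A right Kan extension of $F$ along $H$ is a pair $(LF\colon\mathcal{H}\to\mathcal{D},\ \lambda\colon LF\circ H\Rightarrow F)$ such that for every $X\colon\mathcal{H}\to\mathcal{D}$ and $\tau\colon X\circ H\Rightarrow F$ there is a unique $\bar\tau\colon X\Rightarrow LF$ with $\lambda\circ\bar\tau_H=\tau$. It is absolute if for every functor $Y\colon\mathcal{D}\to\mathcal{E}$ the pair $(Y\circ LF,Y\lambda)$ is a right Kan extension of $Y\circ F$ along $H$. Naturality in $\mathcal{E}$ means: $\varphi_{\mathcal{E}',Z\circ X,Z\circ Y}(Z\tau)=Z\,\varphi_{\mathcal{E},X,Y}(\tau)$ for every functor $Z\colon\mathcal{E}\to\mathcal{E}'$. Naturality in $X$ means $\varphi_{\mathcal{E},X',Y}(\tau\circ\alpha)=\varphi_{\mathcal{E},X,Y}(\tau)\circ\alpha_H$ for $\alpha\colon X'\Rightarrow X$; naturality in $Y$ means $\varphi_{\mathcal{E},X,Y'}(\beta_{LF}\circ\tau)=\beta_F\circ\varphi_{\mathcal{E},X,Y}(\tau)$ for $\beta\colon Y\Rightarrow Y'$. *)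

(* Defs.v *)
From mathcomp Require Import ssreflect ssrfun.

Set Implicit Arguments.
Unset Strict Implicit.
Unset Printing Implicit Defensive.

(* Objects and morphisms live in fixed universes, so that "all categories"
   below means all categories of one universe, [C], [D], [H] included. *)
Record Category := {
  obj :> Type;
  hom : obj -> obj -> Type;
  idm : forall x, hom x x;
  compm : forall x y z, hom y z -> hom x y -> hom x z;
  compm_id_l : forall x y (f : hom x y), compm (idm y) f = f;
  compm_id_r : forall x y (f : hom x y), compm f (idm x) = f;
  compm_assoc : forall w x y z (h : hom y z) (g : hom x y) (f : hom w x),
    compm h (compm g f) = compm (compm h g) f
}.
Arguments hom {c} _ _.
Arguments idm {c} x.
Arguments compm {c x y z} _ _.

Record Functor (A B : Category) := {
  fobj :> A -> B;
  fmap : forall x y, hom x y -> hom (fobj x) (fobj y);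
  fmap_id : forall x, fmap (idm x) = idm (fobj x);
  fmap_comp : forall x y z (g : hom y z) (f : hom x y),
    fmap (compm g f) = compm (fmap g) (fmap f)
}.
Arguments fmap {A B} _ {x y} _.

Definition fid (A : Category) : Functor A A.
Proof.
by refine {| fobj := fun x : A => x; fmap := fun x y (f : hom x y) => f |}.
Defined.

Definition fcomp (A B C : Category) (G : Functor B C) (F : Functor A B) :
  Functor A C.
Proof.
refine {| fobj := fun x => G (F x);
          fmap := fun x y (f : hom x y) => fmap G (fmap F f) |}.
- by move=> x; rewrite !fmap_id.
- by move=> x y z g f; rewrite !fmap_comp.
Defined.

Notation "G '⊚' F" := (fcomp G F) (at level 40, left associativity).

(* [Nat F G] unfolds to a type that mentions only the object and morphism maps
   of [F] and [G]. Hence [Nat] does not distinguish, up to conversion,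
   [(Z ⊚ Y) ⊚ X] from [Z ⊚ (Y ⊚ X)], nor [F ⊚ fid A] and [fid B ⊚ F] from [F],
   and no associators or unitors are needed below. *)
Definition Nat (A B : Category) (F G : Functor A B) : Type :=
  {a : forall x, hom (F x) (G x) |
    forall x y (f : hom x y), compm (a y) (fmap F f) = compm (fmap G f) (a x)}.

Definition component (A B : Category) (F G : Functor A B) (a : Nat F G) (x : A) :
  hom (F x) (G x) := proj1_sig a x.

Definition nid (A B : Category) (F : Functor A B) : Nat F F.
Proof.
exists (fun x => idm (F x)).
by move=> x y f; rewrite compm_id_l compm_id_r.
Defined.

Definition vcomp (A B : Category) (F G K : Functor A B)
  (b : Nat G K) (a : Nat F G) : Nat F K.
Proof.
exists (fun x => compm (component b x) (component a x)).
case: a b => [a Ha] [b Hb] x y f.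
by rewrite /component /= -compm_assoc Ha compm_assoc Hb compm_assoc.
Defined.

Notation "b '⊙' a" := (vcomp b a) (at level 40, left associativity).

(* [postwhisker K a] is K a, and [prewhisker a K] is a_K. *)
Definition postwhisker (A B C : Category) (F G : Functor A B)
  (K : Functor B C) (a : Nat F G) : Nat (K ⊚ F) (K ⊚ G).
Proof.
exists (fun x => fmap K (component a x)).
case: a => [a Ha] x y f.
by rewrite /component /= -!fmap_comp Ha.
Defined.

Definition prewhisker (A B C : Category) (F G : Functor B C)
  (a : Nat F G) (K : Functor A B) : Nat (F ⊚ K) (G ⊚ K).
Proof.
exists (fun x => component a (K x)).
by case: a => [a Ha] x y f; apply: Ha.
Defined.

Definition is_right_kan_extension (C D Hc : Category)
  (F : Functor C D) (H : Functor C Hc)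
  (LF : Functor Hc D) (lam : Nat (LF ⊚ H) F) : Prop :=
  forall (X : Functor Hc D) (tau : Nat (X ⊚ H) F),
    exists! taubar : Nat X LF, lam ⊙ prewhisker taubar H = tau.

Definition is_absolute_right_kan_extension (C D Hc : Category)
  (F : Functor C D) (H : Functor C Hc)
  (LF : Functor Hc D) (lam : Nat (LF ⊚ H) F) : Prop :=
  is_right_kan_extension lam /\
  forall (E : Category) (Y : Functor D E),
    @is_right_kan_extension C E Hc (Y ⊚ F) H (Y ⊚ LF) (postwhisker Y lam).

Section Families.

Variables (C D Hc : Category) (F : Functor C D) (H : Functor C Hc).
Variable LF : Functor Hc D.

Definition family : Type :=
  forall (E : Category) (X : Functor Hc E) (Y : Functor D E),
    Nat X (Y ⊚ LF) -> Nat (X ⊚ H) (Y ⊚ F).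

Definition bijective_family (phi : family) : Prop :=
  forall (E : Category) (X : Functor Hc E) (Y : Functor D E),
    bijective (phi E X Y).

Definition natural_in_E (phi : family) : Prop :=
  forall (E E' : Category) (Z : Functor E E')
    (X : Functor Hc E) (Y : Functor D E) (tau : Nat X (Y ⊚ LF)),
    phi E' (Z ⊚ X) (Z ⊚ Y) (postwhisker Z tau) = postwhisker Z (phi E X Y tau).

Definition natural_in_X (phi : family) : Prop :=
  forall (E : Category) (X X' : Functor Hc E) (Y : Functor D E)
    (alpha : Nat X' X) (tau : Nat X (Y ⊚ LF)),
    phi E X' Y (tau ⊙ alpha) = phi E X Y tau ⊙ prewhisker alpha H.

Definition natural_in_Y (phi : family) : Prop :=
  forall (E : Category) (X : Functor Hc E) (Y Y' : Functor D E)
    (beta : Nat Y Y') (tau : Nat X (Y ⊚ LF)),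
    phi E X Y' (prewhisker beta LF ⊙ tau) = prewhisker beta F ⊙ phi E X Y tau.

Definition family_of_nat (lam : Nat (LF ⊚ H) F) : family :=
  fun E X Y tau => postwhisker Y lam ⊙ prewhisker tau H.

Definition nat_of_family (phi : family) : Nat (LF ⊚ H) F :=
  phi D LF (fid D) (nid LF).

End Families.

(* Main.v *)
(** Naturality in X determines a family phi by its values at identities,
    phi(tau) = phi_{E, Y LF, Y}(id) tau_H, and naturality in the category, applied
    to the functor Y itself, gives phi_{E, Y LF, Y}(id) = Y phi_{D, LF, id}(id).
    Hence every family natural in E and X has the form tau |-> Y lam . tau_H with
    lam = phi_{D, LF, id}(id), and bijectivity of that map for all X is precisely
    the universal property of (Y LF, Y lam). *)

Require Import Defs.
From mathcomp Require Import ssreflect ssrfun.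
From Stdlib Require Import FunctionalExtensionality ProofIrrelevance.
From Stdlib Require Import IndefiniteDescription.

Set Implicit Arguments.
Unset Strict Implicit.
Unset Printing Implicit Defensive.

(** Functional extensionality identifies the component maps, and proof irrelevance the naturality
    proofs. *)
Lemma nat_ext (A B : Category) (F G : Functor A B) (a b : Nat F G) :
  (forall x, component a x = component b x) -> a = b.
Proof.
case: a b => [a Ha] [b Hb] /= eq_ab.
have {}eq_ab : a = b by apply: functional_extensionality_dep.
by subst b; congr exist; apply: proof_irrelevance.
Qed.

Lemma component_natural (A B : Category) (F G : Functor A B) (a : Nat F G)
  (x y : A) (f : hom x y) :
  compm (component a y) (fmap F f) = compm (fmap G f) (component a x).
Proof. exact: (proj2_sig a). Qed.

(** [bijective] asks for an inverse function, which is chosen here by indefinite description. *)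
Lemma unique_preimage_bijective (S T : Type) (f : S -> T) :
  (forall y, exists! x, f x = y) -> bijective f.
Proof.
move=> uniq_f.
pose g y := proj1_sig (constructive_indefinite_description _ (uniq_f y)).
have gP y : unique (fun x => f x = y) (g y).
  exact: proj2_sig (constructive_indefinite_description _ (uniq_f y)).
exists g => [x | y]; last by case: (gP y).
by case: (gP (f x)) => _; apply.
Qed.

Lemma bijective_unique_preimage (S T : Type) (f : S -> T) :
  bijective f -> forall y, exists! x, f x = y.
Proof. by case=> g fK gK y; exists (g y); split=> [|x <-]; rewrite ?gK ?fK. Qed.

Section Families.

Variables (C D Hc : Category) (F : Functor C D) (H : Functor C Hc).
Variable LF : Functor Hc D.

Implicit Types (lam : Nat (LF ⊚ H) F) (phi : family F H LF).

Lemma family_of_nat_natural_in_E lam : natural_in_E (family_of_nat lam).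
Proof. by move=> E E' Z X Y tau; apply: nat_ext => x /=; rewrite -fmap_comp. Qed.

Lemma family_of_nat_natural_in_X lam : natural_in_X (family_of_nat lam).
Proof. by move=> E X X' Y alpha tau; apply: nat_ext => x /=; rewrite compm_assoc. Qed.

(** This is the naturality square of [beta] at the components of [lam]. *)
Lemma family_of_nat_natural_in_Y lam : natural_in_Y (family_of_nat lam).
Proof.
move=> E X Y Y' beta tau; apply: nat_ext => x /=.
rewrite [LHS]compm_assoc [RHS]compm_assoc; congr (compm _ _).
by symmetry; apply: component_natural.
Qed.

Lemma nat_of_family_of_nat lam : nat_of_family (family_of_nat lam) = lam.
Proof. by apply: nat_ext => x /=; apply: compm_id_r. Qed.

(* [Y ⊚ fid D] and [Y] have convertible object and morphism maps, but are only
   propositionally equal because their proofs of functoriality differ. *)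
Lemma family_fcomp_fid phi (E : Category) (X : Functor Hc E) (Y : Functor D E)
  (tau : Nat X (Y ⊚ LF)) :
  phi E X (Y ⊚ fid D) tau = phi E X Y tau.
Proof.
case: Y tau => o m m_id m_comp tau.
(* With arbitrary functoriality proofs as variables, proof irrelevance can rewrite them; [tau] stays
   well typed by conversion. *)
have irr m_id' m_comp' :
    phi E X (@Build_Functor D E o m m_id' m_comp') tau =
    phi E X (@Build_Functor D E o m m_id m_comp) tau.
  by rewrite (proof_irrelevance _ m_id' m_id) (proof_irrelevance _ m_comp' m_comp).
exact: irr.
Qed.

Lemma family_of_nat_of_family phi :
  natural_in_E phi -> natural_in_X phi ->
  family_of_nat (nat_of_family phi) = phi.
Proof.
move=> natE natX.
apply: functional_extensionality_dep => E.
apply: functional_extensionality_dep => X.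
apply: functional_extensionality_dep => Y.
apply: functional_extensionality_dep => tau.
have lamE : phi E (Y ⊚ LF) Y (nid (Y ⊚ LF)) = postwhisker Y (nat_of_family phi).
  (* Naturality in the category with [Z := Y] yields a value of [phi] at [Y ⊚ fid D], not at [Y]. *)
  rewrite -family_fcomp_fid.
  have -> : nid (Y ⊚ LF) = postwhisker Y (nid LF).
    by apply: nat_ext => x /=; symmetry; apply: fmap_id.
  exact: (natE D E Y LF (fid D) (nid LF)).
have -> : phi E X Y tau = phi E (Y ⊚ LF) Y (nid (Y ⊚ LF)) ⊙ prewhisker tau H.
  rewrite -natX; congr (phi _ _ _ _).
  by apply: nat_ext => x /=; rewrite [RHS]compm_id_l.
by rewrite lamE; apply: nat_ext.
Qed.

Lemma absolute_kan_bijective lam :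
  is_absolute_right_kan_extension lam -> bijective_family (family_of_nat lam).
Proof.
by move=> [_ kan] E X Y; apply: unique_preimage_bijective; apply: kan.
Qed.

(** Bijectivity at each [Y] is the universal property of (Y LF, Y lam); the plain Kan property is
    the case of the identity functor. *)
Lemma bijective_absolute_kan lam :
  bijective_family (family_of_nat lam) -> is_absolute_right_kan_extension lam.
Proof.
move=> bij; split=> [X tau | E Y X tau]; last first.
  exact: (bijective_unique_preimage (bij E X Y)).
have fidE (t : Nat X LF) :
    @family_of_nat C D Hc F H LF lam D X (fid D) t = lam ⊙ prewhisker t H.
  exact: nat_ext.
have [t [tP t_uniq]] := bijective_unique_preimage (bij D X (fid D)) tau.
exists t; split=> [|t' t'P]; first by rewrite -fidE.
by apply: t_uniq; rewrite fidE.
Qed.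

End Families.

Theorem proposition2p10 (C D Hc : Category) (F : Functor C D) (H : Functor C Hc) :
  (forall (LF : Functor Hc D) (lam : Nat (LF ⊚ H) F),
     is_absolute_right_kan_extension lam ->
     bijective_family (family_of_nat lam) /\
     natural_in_E (family_of_nat lam) /\
     natural_in_X (family_of_nat lam) /\
     natural_in_Y (family_of_nat lam))
  /\
  (forall (LF : Functor Hc D) (phi : family F H LF),
     bijective_family phi -> natural_in_E phi -> natural_in_X phi ->
     natural_in_Y phi /\ is_absolute_right_kan_extension (nat_of_family phi))
  /\
  (forall (LF : Functor Hc D) (lam : Nat (LF ⊚ H) F),
     is_absolute_right_kan_extension lam ->
     nat_of_family (family_of_nat lam) = lam)
  /\
  (forall (LF : Functor Hc D) (phi : family F H LF),
     bijective_family phi -> natural_in_E phi -> natural_in_X phi ->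
     family_of_nat (nat_of_family phi) = phi).
Proof.
split=> [LF lam kan|].
  split; first exact: absolute_kan_bijective.
  split; first exact: family_of_nat_natural_in_E.
  split; first exact: family_of_nat_natural_in_X.
  exact: family_of_nat_natural_in_Y.
split=> [LF phi bij natE natX|].
  have phiE := family_of_nat_of_family natE natX.
  (* Naturality in [Y] is automatic because [phi] equals a family induced by a transformation. *)
  split; first by rewrite -phiE; apply: family_of_nat_natural_in_Y.
  by apply: bijective_absolute_kan; rewrite phiE.
split=> [LF lam _ | LF phi _]; first exact: nat_of_family_of_nat.
exact: family_of_nat_of_family.
Qed.
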